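(* Let $\mathcal{I}$ be an instance with class formula $\Delta$. Let the NNF $\Delta_c$ be the complete reason for the decision on $\mathcal{I}$ (in the form of an or-decomposable NNF), let the NNF $\Delta_g$ be the general reason for the decision on $\mathcal{I}$, and let $V$ be the set (of sets of variables) computed by $\mathrm{Robustness}(\Delta_c)$ as its second output. Then $\mathrm{sGNR}(\Delta_g,V)$ outputs the set of all shortest general necessary reasons (GNRs) for the decision on $\mathcal{I}$. (Robustness and sGNR are the procedures defined in the context.)
   Context: Discrete logic. There is a finite set of variables, each variable $X$ having a finite set of at least two states. An $X$-literal is a nonempty proper subset of the states of $X$ (true when the state of $X$ lies in it); it is simple if it is a singleton. A clause is a disjunction of literals (literals of the same variable are merged by union). A CNF is a conjunction of clauses. An NNF is a formula built from literals and the constants true, false with $\wedge,\vee$ only; it is or-decomposable if in each disjunction in it the disjuncts share no variables. $\mathrm{vars}(\cdot)$ is the set of variables occurring in a formula. Clause $\sigma_1$ subsumes clause $\sigma_2$ iff $\sigma_1\models\sigma_2$. An implicate of a formula is a clause implied by it; it is prime if no other implicate implies it. Reasons. An instance $\mathcal{I}$ is a conjunction of one simple literal for each variable; its class formula $\Delta$ encodes the instances in its class, so $\mathcal{I}\models\Delta$. The complete reason for the decision on $\mathcal{I}$ is (up to equivalence) the weakest NNF that implies $\Delta$ and all of whose literals are contained in $\mathcal{I}$ (as an NNF, it is represented with such literals). The general reason is (up to equivalence) the weakest NNF that implies $\Delta$ and all of whose literals are implied by $\mathcal{I}$ (as an NNF, it is represented with such literals). A GNR is a prime implicate $\sigma$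 of the general reason that is variable-minimal: no prime implicate $\sigma'$ of the general reason has $\mathrm{vars}(\sigma')\subsetneq\mathrm{vars}(\sigma)$. A GNR $\sigma$ is shortest if no GNR $\sigma'$ has $|\mathrm{vars}(\sigma')|<|\mathrm{vars}(\sigma)|$. Resolution. If $\alpha=l_1\vee\sigma_1$ and $\beta=l_2\vee\sigma_2$ are clauses with $X$-literals $l_1,l_2$, and $\sigma=(l_1\wedge l_2)\vee\sigma_1\vee\sigma_2$ is not equivalent to true, the $X$-resolvent of $\alpha,\beta$ is the clause equivalent to $\sigma$. Procedure $\mathrm{Robustness}(\Delta)$, for an or-decomposable NNF $\Delta$, returns a pair $(r,V)$: if $\Delta$ is true, $(\infty,\emptyset)$; if false, $(0,\{\emptyset\})$; if a literal, $(1,\{\mathrm{vars}(\Delta)\})$; if $\Delta=\alpha\wedge\beta$ with $(r_1,V_1)=\mathrm{Robustness}(\alpha)$, $(r_2,V_2)=\mathrm{Robustness}(\beta)$: $(r_1,V_1)$ if $r_1<r_2$, $(r_2,V_2)$ if $r_1>r_2$, and $(r_1,V_1\cup V_2)$ if $r_1=r_2$; if $\Delta=\alpha\vee\beta$, with the same notation: $(r_1+r_2,\{v_1\cup v_2: v_1\in V_1,v_2\in V_2\})$. Procedure $\mathrm{sCNF}(\Delta,V)$ returns a CNF $\Gamma$: if $\Delta$ is true or false, return $\Delta$; if $\Delta$ is a literal, return $\Delta$ if $\mathrm{vars}(\Delta)\subseteq v_i$ for some $v_i\in V$, and otherwise return false; if $\Delta=\alpha\wedge\beta$, let $\Gamma=\mathrm{sCNF}(\alpha,V)\wedge\mathrm{sCNF}(\beta,V)$;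 if $\Delta=\alpha\vee\beta$, start with $\Gamma=$ true and, for every clause $c_1$ in $\mathrm{sCNF}(\alpha,V)$ and every clause $c_2$ in $\mathrm{sCNF}(\beta,V)$, let $c=c_1\vee c_2$ and replace $\Gamma$ by $\Gamma\wedge c$ if $\mathrm{vars}(c)\subseteq v_i$ for some $v_i\in V$; in the last two cases remove subsumed clauses in $\Gamma$ and return $\Gamma$. Procedure $\mathrm{sGNR}(\Delta,V)$: let $\Gamma=\mathrm{sCNF}(\Delta,V)$ and $s=\emptyset$. For every $v_i\in V$, let $s_i$ be the set of clauses $c$ in $\Gamma$ with $\mathrm{vars}(c)=v_i$; then, for every variable $v\in v_i$ in turn, resolve exhaustively on $v$: for every pair $c_1,c_2\in s_i$, let $c$ be the resolvent of $c_1$ and $c_2$ on $v$ and, if $c$ is not subsumed by some clause in $s_i$, add $c$ to $s_i$ and remove the clauses subsumed by $c$ in $s_i$; after all variables of $v_i$ are processed, replace $s$ by $s\cup s_i$. Return $s$.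
   Formalization: In sCNF, a literal whose variable lies in no v_i yields the CNF with no clauses (true) instead of false; with false read as the empty clause the claim fails, e.g. for x∧(y∨z) with instance xyz, where sGNR would return the empty set instead of {x}. *)

(* Defs.v *)
From mathcomp Require Import all_boot.

Set Implicit Arguments.
Unset Strict Implicit.
Unset Printing Implicit Defensive.

Section DiscreteLogic.

Context (Var : finType) (St : Var -> finType).

(* A world assigns a state to every variable.  An instance, i.e. a conjunction
   of one simple literal per variable, is represented by its only model. *)
Definition world := {dffun forall X : Var, St X}.

Definition entails (p q : pred world) : bool := [forall w, p w ==> q w].

Definition is_literal (X : Var) (A : {set St X}) : bool :=
  (A != set0) && (A != setT).

Definition literal (X : Var) := {A : {set St X} | is_literal A}.

Inductive nnf : Type :=
  | NTrue
  | NFalse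
  | NLit (X : Var) (l : literal X)
  | NAnd (f g : nnf)
  | NOr (f g : nnf).

Fixpoint nsat (f : nnf) (w : world) : bool :=
  match f with
  | NTrue => true
  | NFalse => false
  | NLit X l => w X \in val l
  | NAnd f g => nsat f w && nsat g w
  | NOr f g => nsat f w || nsat g w
  end.

Fixpoint nvars (f : nnf) : {set Var} :=
  match f with
  | NTrue | NFalse => set0
  | NLit X _ => [set X]
  | NAnd f g | NOr f g => nvars f :|: nvars g
  end.

Fixpoint or_decomposable (f : nnf) : bool :=
  match f with
  | NTrue | NFalse | NLit _ _ => true
  | NAnd f g => or_decomposable f && or_decomposable g
  | NOr f g => [&& [disjoint nvars f & nvars g],
                   or_decomposable f & or_decomposable g]
  end.

(* A clause is in merged form: it has at most one literal per variable, and
   set0 at X means that X does not occur.  Valid disjunctions are thus not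
   clauses, and equivalent clauses are equal when every variable has at least
   two states. *)
Definition is_clause (c : {dffun forall X : Var, {set St X}}) : bool :=
  [forall X, (c X == set0) || is_literal (c X)].

Definition clause := {c : {dffun forall X : Var, {set St X}} | is_clause c}.

Definition csat (c : clause) (w : world) : bool := [exists X, w X \in val c X].

Definition cvars (c : clause) : {set Var} := [set X | val c X != set0].

Definition subsumes (c1 c2 : clause) : bool := entails (csat c1) (csat c2).

Definition implicate (f : nnf) (c : clause) : bool :=
  entails (nsat f) (csat c).

Definition prime_implicate (f : nnf) (c : clause) : bool :=
  implicate f c &&
  [forall c' : clause, implicate f c' && subsumes c' c ==> (c' == c)].

(* Formulas for the class only matter up to equivalence, so the
   class formula is given by the predicate of its models. *)

Fixpoint all_literals (P : forall X : Var, literal X -> bool) (f : nnf) : bool :=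
  match f with
  | NTrue | NFalse => true
  | NLit X l => P X l
  | NAnd f g | NOr f g => all_literals P f && all_literals P g
  end.

Definition literal_in (I : world) (X : Var) (l : literal X) : bool :=
  val l == [set I X].

Definition literal_implied (I : world) (X : Var) (l : literal X) : bool :=
  I X \in val l.

Definition weakest_reason (P : forall X : Var, literal X -> bool)
    (Delta : pred world) (f : nnf) : Prop :=
  [/\ all_literals P f, entails (nsat f) Delta &
      forall g, all_literals P g -> entails (nsat g) Delta ->
                entails (nsat g) (nsat f)].

Definition complete_reason (I : world) (Delta : pred world) (f : nnf) : Prop :=
  weakest_reason (literal_in I) Delta f.

Definition general_reason (I : world) (Delta : pred world) (f : nnf) : Prop :=
  weakest_reason (literal_implied I) Delta f.

(* In GNR and shortest_GNR, f is the general reason. *)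
Definition GNR (f : nnf) (c : clause) : bool :=
  prime_implicate f c &&
  [forall c' : clause, prime_implicate f c' ==> ~~ (cvars c' \proper cvars c)].

Definition shortest_GNR (f : nnf) (c : clause) : bool :=
  GNR f c && [forall c' : clause, GNR f c' ==> ~~ (#|cvars c'| < #|cvars c|)].

(* Extended naturals, with None for infinity. *)
Definition ltno (r1 r2 : option nat) : bool :=
  match r1, r2 with
  | Some n1, Some n2 => n1 < n2
  | Some _, None => true
  | None, _ => false
  end.

Definition addno (r1 r2 : option nat) : option nat :=
  match r1, r2 with
  | Some n1, Some n2 => Some (n1 + n2)
  | _, _ => None
  end.

Fixpoint robustness (f : nnf) : option nat * {set {set Var}} :=
  match f with
  | NTrue => (None, set0)
  | NFalse => (Some 0, [set set0])
  | NLit X _ => (Some 1, [set [set X]])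
  | NAnd f g =>
      let: (r1, V1) := robustness f in
      let: (r2, V2) := robustness g in
      if ltno r1 r2 then (r1, V1)
      else if ltno r2 r1 then (r2, V2)
      else (r1, V1 :|: V2)
  | NOr f g =>
      let: (r1, V1) := robustness f in
      let: (r2, V2) := robustness g in
      (addno r1 r2, [set v1 :|: v2 | v1 in V1, v2 in V2])
  end.

(* A CNF is the set of its clauses: true is set0, and false is the set whose
   only element is the empty clause. *)

Definition clause_of_literal (X : Var) (l : literal X) : option clause :=
  insub (finfun (dfwith (fun Y => set0 : {set St Y}) (val l))).

(* None when the disjunction is valid; it then adds nothing to a CNF. *)
Definition clause_or (c1 c2 : clause) : option clause :=
  insub (finfun (fun X => val c1 X :|: val c2 X)).

(* None unless X occurs in both clauses and the result is not valid. *)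
Definition resolvent (X : Var) (c1 c2 : clause) : option clause :=
  if (X \in cvars c1) && (X \in cvars c2) then
    insub (finfun (fun Y => if Y == X then val c1 Y :&: val c2 Y
                            else val c1 Y :|: val c2 Y))
  else None.

Definition rm_subsumed (G : {set clause}) : {set clause} :=
  [set c in G | [forall c' in G, (c' != c) ==> ~~ subsumes c' c]].

Definition within (v : {set Var}) (V : {set {set Var}}) : bool :=
  [exists vi in V, v \subset vi].

(* A literal whose variable lies outside every element of V is pruned: it
   yields the CNF with no clauses.  Yielding the empty clause instead would be
   unsound: on x /\ (y \/ z) with V = {{X}}, the pruned y \/ z would become the
   empty clause, which subsumes the clause x. *)
Fixpoint sCNF (f : nnf) (V : {set {set Var}}) : {set clause} :=
  match f with
  | NTrue => set0
  | NFalse => [set c | cvars c == set0]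
  | NLit X l => if within [set X] V
                then [set c | clause_of_literal l == Some c] else set0
  | NAnd f g => rm_subsumed (sCNF f V :|: sCNF g V)
  | NOr f g =>
      rm_subsumed
        [set c | [exists c1 in sCNF f V, exists c2 in sCNF g V,
                    clause_or c1 c2 == Some c] & within (cvars c) V]
  end.

(* The order in which pairs of clauses, and the variables of each vi, are
   processed is left open, so sGNR is a relation between inputs and outputs. *)

Definition resolve_step (X : Var) (s t : {set clause}) : Prop :=
  exists c1 c2 c : clause,
    [/\ c1 \in s, c2 \in s, resolvent X c1 c2 = Some c,
        ~~ [exists c' in s, subsumes c' c] &
        t = c |: [set c' in s | ~~ subsumes c c']].

Inductive resolve_exhaustively (X : Var) :
    {set clause} -> {set clause} -> Prop :=
  | resolve_done s :
      (forall t, ~ resolve_step X s t) -> resolve_exhaustively X s s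
  | resolve_more s t u :
      resolve_step X s t -> resolve_exhaustively X t u ->
      resolve_exhaustively X s u.

Fixpoint resolve_vars (Xs : seq Var) (s t : {set clause}) : Prop :=
  match Xs with
  | [::] => t = s
  | X :: Xs' => exists2 u, resolve_exhaustively X s u & resolve_vars Xs' u t
  end.

Definition sGNR (f : nnf) (V : {set {set Var}}) (s : {set clause}) : Prop :=
  exists2 S : {set Var} -> {set clause},
    forall vi, vi \in V ->
      exists2 Xs, perm_eq Xs (enum vi) &
        resolve_vars Xs [set c in sCNF f V | cvars c == vi] (S vi)
    & s = \bigcup_(vi in V) S vi.

(* No resolution loop runs forever, whatever the choices made. *)
Lemma resolve_step_wf (X : Var) :
  well_founded (fun t s => resolve_step X s t).
Proof.
have refl c : subsumes c c by apply/forallP => w; apply/implyP.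
have trans c1 c2 c3 : subsumes c1 c2 -> subsumes c2 c3 -> subsumes c1 c3.
  move=> /forallP h12 /forallP h23; apply/forallP => w; apply/implyP => h.
  by apply: (implyP (h23 w)); apply: (implyP (h12 w)).
pose up (s : {set clause}) := [set c | [exists c' in s, subsumes c' c]].
have up_step s t : resolve_step X s t -> up s \proper up t.
  case=> c1 [c2 [c [_ _ _ cNs ->]]]; apply/properP; split.
    apply/subsetP => d; rewrite !inE => /existsP[e /andP[es ed]].
    apply/existsP; have [ce|Nce] := boolP (subsumes c e).
      by exists c; rewrite !inE eqxx /=; apply: trans ed.
    by exists e; rewrite !inE es Nce ed orbT.
  exists c; rewrite inE //.
  by apply/existsP; exists c; rewrite !inE eqxx /=.
move=> s; have [n] := ubnP #|~: up s|.
elim: n s => [s|n IH s lt_sn]; first by rewrite ltn0.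
constructor => t /up_step lt_st.
apply: IH; rewrite -ltnS; apply: leq_trans lt_sn.
apply: proper_card; move: lt_st; rewrite !properEneq setCS => /andP[neq ->].
by rewrite (inj_eq (@setC_inj _)) eq_sym neq.
Qed.

End DiscreteLogic.

Arguments NTrue {Var St}.
Arguments NFalse {Var St}.

(* Main.v *)
(* Say that v is falsifiable when some world outside Delta agrees with I off v.
   By or-decomposability, Robustness computes the smallest falsifiable sets.
   Every literal of the general reason holds at I, so its implicates with
   variables within v amount to the worlds that agree with I off v; hence the
   shortest GNRs are the prime implicates whose variables form a set v of V,
   and on worlds agreeing with I off v only the clauses of sCNF within v matter.
   By minimality of v, these clauses have v as set of variables.  Resolving on
   one variable after the other is then Tison's method, seen through boxes: the
   falsifying set of a clause is a product of sets of states, and resolving on X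
   merges boxes along X, so that one pass produces all the maximal boxes. *)

Require Import Defs.
From mathcomp Require Import all_boot.

Set Implicit Arguments.
Unset Strict Implicit.
Unset Printing Implicit Defensive.

Section Clauses.

Context (Var : finType) (St : Var -> finType).
Context (St_ge2 : forall X : Var, 1 < #|St X|).

Implicit Types (w : world St) (c d : clause St) (f g : nnf St).
Implicit Types (s t : {set clause St}) (v : {set Var}) (V : {set {set Var}}).

(** * Worlds, clauses and subsumption *)

Lemma exists_world (B : forall X, {set St X}) :
  (forall X, B X != set0) -> exists w, forall X, w X \in B X.
Proof.
move=> B0; have [X|h hB] := @fin_all_exists _ St (fun X a => a \in B X).
  exact/set0Pn.
by exists (finfun h) => X; rewrite ffunE.
Qed.

Lemma set0_neqT X : (set0 : {set St X}) != setT.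
Proof. by rewrite eq_sym -card_gt0 cardsT (ltn_trans _ (St_ge2 X)). Qed.

Lemma clause_neqT c X : val c X != setT.
Proof.
have /forallP/(_ X)/orP[/eqP->|/andP[]//] := valP c.
exact: set0_neqT.
Qed.

Lemma set0_or_literal X (A : {set St X}) :
  A != setT -> (A == set0) || is_literal A.
Proof. by rewrite /is_literal => ->; rewrite andbT orbN. Qed.

Lemma csatPn c w : reflect (forall X, w X \notin val c X) (~~ csat c w).
Proof. by rewrite /csat negb_exists; apply: forallP. Qed.

Lemma in_cvars c X : (X \in cvars c) = (val c X != set0).
Proof. by rewrite inE. Qed.

Lemma notin_cvars c X : X \notin cvars c -> val c X = set0.
Proof. by rewrite inE negbK => /eqP. Qed.

Lemma entailsP (p q : pred (world St)) :
  reflect (forall w, p w -> q w) (entails p q).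
Proof. by apply: (iffP forallP) => h w; apply/implyP/h. Qed.

Lemma subsumesP c d :
  reflect (forall X, val c X \subset val d X) (subsumes c d).
Proof.
apply: (iffP (entailsP _ _)) => [cd X|cd w /existsP[X wX]]; last first.
  by apply/existsP; exists X; apply: (subsetP (cd X)).
apply/subsetP => a ac; apply/negPn/negP => aNd.
(* The world has at [X] a state of [c] outside [d] and falsifies [d] elsewhere, which is possible
   because no literal is full; it satisfies [c] but not [d]. *)
have [|w wB] := exists_world
    (B := fun Y => ~: val d Y :&: [set b | (Y == X) ==> (b \in val c Y)]).
  move=> Y; have [->|_] := eqVneq Y X.
    by apply/set0Pn; exists a; rewrite !inE aNd ac.
  have /set0Pn[b bNd] : ~: val d Y != set0.
    by rewrite -setCT (inj_eq (@setC_inj _)) clause_neqT.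
  by apply/set0Pn; exists b; rewrite in_setI bNd inE.
have /cd : csat c w.
  by apply/existsP; exists X; move: (wB X); rewrite !inE eqxx => /andP[].
by apply/negP/csatPn => Y; move: (wB Y); rewrite !inE => /andP[].
Qed.

Lemma subsumes_refl c : subsumes c c.
Proof. exact/entailsP. Qed.

Lemma subsumes_trans c1 c2 c3 :
  subsumes c1 c2 -> subsumes c2 c3 -> subsumes c1 c3.
Proof.
by move=> /entailsP h12 /entailsP h23; apply/entailsP => w /h12/h23.
Qed.

Lemma subsumes_anti c d : subsumes c d -> subsumes d c -> c = d.
Proof.
move=> /subsumesP cd /subsumesP dc; apply/val_inj/ffunP => X.
by apply/eqP; rewrite eqEsubset cd dc.
Qed.

Lemma subsumes_cvars c d : subsumes c d -> cvars c \subset cvars d.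
Proof.
move=> /subsumesP cd; apply/subsetP => X; rewrite !in_cvars.
by apply: contraNneq => d0; rewrite -subset0 -d0.
Qed.

Lemma subsumes_csatN c d w : subsumes c d -> ~~ csat d w -> ~~ csat c w.
Proof. by move=> /entailsP/(_ w) cd; apply: contra. Qed.

(** Subsumption is inclusion of the sets of satisfying worlds and is antisymmetric, so a clause of
    [A] below [c] with the fewest satisfying worlds is minimal. *)
Lemma exists_minimal (A : pred (clause St)) c : A c ->
  exists c', [/\ A c', subsumes c' c &
                 forall d, A d -> subsumes d c' -> d = c'].
Proof.
move=> Ac.
have Pc : [pred d | A d && subsumes d c] c by rewrite /= Ac subsumes_refl.
case: (arg_minnP (fun d => #|[set w | csat d w]|) Pc) => /=.
move=> c' /andP[Ac' c'c] c'_min; exists c'; split=> // d Ad dc'.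
apply: subsumes_anti => //; have {}c'_min := c'_min d.
rewrite Ad (subsumes_trans dc') //= in c'_min.
have /eqP eq_sat : [set w | csat d w] == [set w | csat c' w].
  rewrite eqEcard c'_min //= andbT; apply/subsetP => w; rewrite !inE.
  exact: (entailsP _ _ dc').
by apply/entailsP => w; move/setP/(_ w): eq_sat; rewrite !inE => ->.
Qed.

Lemma rm_subsumed_sub s c : c \in rm_subsumed s -> c \in s.
Proof. by rewrite inE => /andP[]. Qed.

Lemma rm_subsumed_cover s c : c \in s ->
  exists2 c', c' \in rm_subsumed s & subsumes c' c.
Proof.
move=> cs; have [c' [c's c'c c'_min]] := exists_minimal (A := mem s) cs.
exists c' => //; rewrite /= in c's.
rewrite inE c's; apply/forallP => d; apply/implyP => ds; apply/implyP.
by apply: contraNN => dc'; apply/eqP/c'_min.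
Qed.

(** An antichain for subsumption. Once every implicate over [v] is subsumed by a member of the
    output, this property makes the members prime. *)
Definition irredundant s :=
  forall c d, c \in s -> d \in s -> subsumes c d -> c = d.

Lemma irredundant_rm s : irredundant (rm_subsumed s).
Proof.
move=> c d /rm_subsumed_sub cs; rewrite inE => /andP[_ /forallP/(_ c)].
by rewrite cs; have [|] := eqVneq c d => //= _ /negPf->.
Qed.

Lemma irredundant_sCNF f V : irredundant (sCNF f V).
Proof.
case: f => [||X l|f g|f g] /=; try exact: irredundant_rm.
- by move=> c d; rewrite inE.
- move=> c d; rewrite !inE => /eqP c0 /eqP d0 _.
  by apply/val_inj/ffunP => X; rewrite !notin_cvars ?c0 ?d0 ?inE.
- case: ifP => _ c d; rewrite !inE // => /eqP-> /eqP[->] //.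
Qed.

(** * Disjunctions and literals as clauses *)

Lemma clause_orP c1 c2 c : clause_or c1 c2 = Some c ->
  forall X, val c X = val c1 X :|: val c2 X.
Proof.
by rewrite /clause_or; case: insubP => // u _ uE [<-] X; rewrite uE ffunE.
Qed.

(** The state of [w] stays outside every merged literal, so none of them is full. *)
Lemma clause_or_some c1 c2 w : ~~ csat c1 w -> ~~ csat c2 w ->
  exists c, clause_or c1 c2 = Some c.
Proof.
move=> /csatPn c1w /csatPn c2w; rewrite /clause_or.
case: insubP => [c _ _|/negP[]]; first by exists c.
apply/forallP => X; rewrite ffunE; apply: set0_or_literal.
apply: contraNneq (c1w X) => cT.
by have: w X \in [set: St X]; rewrite // -cT inE (negPf (c2w X)) orbF.
Qed.

Lemma clause_or_csat c1 c2 c w : clause_or c1 c2 = Some c ->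
  csat c w = csat c1 w || csat c2 w.
Proof.
move=> /clause_orP cE; apply/idP/idP.
  case/existsP=> X; rewrite cE inE => /orP[] wX; apply/orP; [left|right];
    by apply/existsP; exists X.
by case/orP=> /existsP[X wX]; apply/existsP; exists X; rewrite cE inE wX ?orbT.
Qed.

Lemma clause_or_cvars c1 c2 c : clause_or c1 c2 = Some c ->
  cvars c = cvars c1 :|: cvars c2.
Proof.
move=> /clause_orP cE; apply/setP => X.
by rewrite in_setU !in_cvars cE setU_eq0 negb_and.
Qed.

Lemma clause_of_literalP X (l : literal St X) c :
  clause_of_literal l = Some c ->
  val c = finfun (dfwith (fun Y => set0 : {set St Y}) (val l)).
Proof. by rewrite /clause_of_literal; case: insubP => // u _ uE [<-]. Qed.

Lemma clause_of_literal_some X (l : literal St X) :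
  exists c, clause_of_literal l = Some c.
Proof.
rewrite /clause_of_literal; case: insubP => [c _ _|/negP[]]; first by exists c.
apply/forallP => Y; rewrite ffunE.
case: dfwithP => [|Z _]; last by rewrite eqxx.
by rewrite (valP l) orbT.
Qed.

Lemma clause_of_literal_csat X (l : literal St X) c w :
  clause_of_literal l = Some c -> csat c w = (w X \in val l).
Proof.
move=> /clause_of_literalP cE; apply/existsP/idP => [[Y]|wX]; last first.
  by exists X; rewrite cE ffunE dfwith_in.
by rewrite cE ffunE; case: dfwithP => // Z _; rewrite inE.
Qed.

Lemma clause_of_literal_cvars X (l : literal St X) c :
  clause_of_literal l = Some c -> cvars c = [set X].
Proof.
move=> /clause_of_literalP cE; apply/setP => Y.
rewrite in_cvars in_set1 cE ffunE.
case: dfwithP => [|Z /negPf XZ]; last by rewrite eqxx eq_sym XZ.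
by rewrite eqxx; case/andP: (valP l).
Qed.

(** * Implicates kept by the pruned CNF *)

Definition agree_off v w0 w := forall X, X \notin v -> w X = w0 X.

(** Pruning and the removal of subsumed clauses only drop clauses, so soundness is that of the usual
    distribution into a CNF. *)
Lemma sCNF_implicate f V c : c \in sCNF f V -> implicate f c.
Proof.
elim: f c => [||X l|f IHf g IHg|f IHf g IHg] c /=.
- by rewrite inE.
- by move=> _; apply/entailsP.
- case: ifP => _; rewrite !inE // => /eqP cE.
  by apply/entailsP => w /=; rewrite (clause_of_literal_csat _ cE).
- move/rm_subsumed_sub; rewrite inE => /orP[/IHf|/IHg] /entailsP h;
    by apply/entailsP => w /= /andP[fw gw]; apply: h.
- move/rm_subsumed_sub; rewrite inE.
  move=> /andP[/existsP[c1 /andP[/IHf/entailsP h1]]].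
  move=> /existsP[c2 /andP[/IHg/entailsP h2 /eqP cE]] _.
  apply/entailsP => w /=; rewrite (clause_or_csat _ cE).
  by case/orP=> [/h1|/h2] ->; rewrite ?orbT.
Qed.

(* Outside v the world w agrees with I, which satisfies every literal of f, so
   the clauses reaching outside v, which may have been pruned, hold at w. *)
Lemma sCNF_falsified I f V v w :
  all_literals (literal_implied I) f -> v \in V -> agree_off v I w ->
  ~~ nsat f w -> exists2 c, c \in sCNF f V & (cvars c \subset v) && ~~ csat c w.
Proof.
move=> + vV wI; have rm s c : c \in s -> (cvars c \subset v) && ~~ csat c w ->
    exists2 c', c' \in rm_subsumed s & (cvars c' \subset v) && ~~ csat c' w.
  move=> /rm_subsumed_cover[c' c's c'c] /andP[cv cw]; exists c' => //.
  by rewrite (subset_trans (subsumes_cvars c'c)) ?(subsumes_csatN c'c).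
elim: f => [||X l|f IHf g IHg|f IHf g IHg] //=.
- move=> _ _; have c0P : is_clause (finfun (fun X => set0 : {set St X})).
    by apply/forallP => X; rewrite ffunE eqxx.
  pose z : clause St := Sub _ c0P.
  have c0 X : val z X = set0 by rewrite SubK ffunE.
  exists z.
    by rewrite inE; apply/eqP/setP => X; rewrite in_cvars c0 eqxx inE.
  apply/andP; split; last by apply/csatPn => X; rewrite c0 inE.
  by apply/subsetP => X; rewrite in_cvars c0 eqxx.
- rewrite /literal_implied => lI wl; have Xv : X \in v.
    by apply: contraNT wl => /wI->.
  have -> : within [set X] V.
    by apply/existsP; exists v; rewrite vV sub1set.
  have [c cE] := clause_of_literal_some l; exists c; first by rewrite inE cE.
  rewrite (clause_of_literal_cvars cE) sub1set Xv.
  by rewrite (clause_of_literal_csat _ cE).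
- case/andP=> fI gI; rewrite negb_and => /orP[/(IHf fI)|/(IHg gI)] [c cs];
    by apply: rm; rewrite inE cs ?orbT.
- case/andP=> fI gI; rewrite negb_or => /andP[].
  move=> /(IHf fI)[c1 c1s /andP[c1v c1w]] /(IHg gI)[c2 c2s /andP[c2v c2w]].
  have [c cE] := clause_or_some c1w c2w.
  have cv : cvars c \subset v by rewrite (clause_or_cvars cE) subUset c1v.
  apply: (rm _ c); last by rewrite cv (clause_or_csat _ cE) negb_or c1w.
  rewrite inE; apply/andP; split; last by apply/existsP; exists v; rewrite vV.
  apply/existsP; exists c1; rewrite c1s; apply/existsP; exists c2.
  by rewrite c2s cE /=.
Qed.

(** * Resolution and Tison's method *)

Lemma resolventP X c1 c2 c : resolvent X c1 c2 = Some c ->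
  forall Y, val c Y = if Y == X then val c1 Y :&: val c2 Y
                      else val c1 Y :|: val c2 Y.
Proof.
rewrite /resolvent; case: ifP => // _; case: insubP => // u _ uE [<-] Y.
by rewrite uE ffunE.
Qed.

Lemma resolvent_cvars X c1 c2 c v : resolvent X c1 c2 = Some c ->
  cvars c1 \subset v -> cvars c2 \subset v -> cvars c \subset v.
Proof.
move=> /resolventP cE c1v c2v; apply/subsetP => Y.
apply: contraTT => Yv; rewrite in_cvars cE.
have /notin_cvars-> : Y \notin cvars c1 by apply: contraNN Yv => /(subsetP c1v).
have /notin_cvars-> : Y \notin cvars c2 by apply: contraNN Yv => /(subsetP c2v).
by rewrite setI0 setU0 if_same eqxx.
Qed.

(** At a world falsifying the resolvent, [c2] can hold only through [X]. The state at [X] then lies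
    in [c2] and not in the intersection, so [c1] fails at [X], and everywhere else as well. *)
Lemma resolvent_implicate X f c1 c2 c : resolvent X c1 c2 = Some c ->
  implicate f c1 -> implicate f c2 -> implicate f c.
Proof.
move=> /resolventP cE /entailsP h1 /entailsP h2; apply/entailsP => w fw.
apply: contraTT (h1 w fw) => /csatPn cw.
have /existsP[Y wY] := h2 w fw.
have YX : Y = X.
  apply/eqP; have := cw Y; rewrite cE; case: eqP => // _.
  by rewrite inE wY orbT.
apply/csatPn => Z; have := cw Z; rewrite cE.
case: eqP => [->|_]; first by rewrite inE -YX wY andbT.
by rewrite inE negb_or => /andP[].
Qed.

(** Off [X] the state of [w] keeps each union proper; at [X] an intersection of two literals is
    never full. *)
Lemma resolvent_some X c1 c2 w : X \in cvars c1 -> X \in cvars c2 ->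
  (forall Y, Y != X -> (w Y \notin val c1 Y) && (w Y \notin val c2 Y)) ->
  exists c, resolvent X c1 c2 = Some c.
Proof.
move=> Xc1 Xc2 wc; rewrite /resolvent Xc1 Xc2 /=.
case: insubP => [c _ _|/negP[]]; first by exists c.
apply/forallP => Y; rewrite ffunE; apply: set0_or_literal.
have [_|/wc/andP[c1w c2w]] := eqVneq Y X.
  apply: contraNneq (clause_neqT c1 Y) => cT.
  by rewrite -subTset -cT subsetIl.
apply: contraNneq c1w => cT.
by have: w Y \in [set: St Y]; rewrite // -cT inE (negPf c2w) orbF.
Qed.

Lemma exhaust_stable X s t (P : pred (clause St)) :
  (forall c1 c2 c, P c1 -> P c2 -> resolvent X c1 c2 = Some c -> P c) ->
  resolve_exhaustively X s t ->
  (forall c, c \in s -> P c) -> forall c, c \in t -> P c.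
Proof.
move=> PR; elim=> // {}s t' u [c1 [c2 [c [c1s c2s cE _ ->]]]] _ IH Ps.
apply: IH => c'; rewrite !inE => /orP[/eqP->|/andP[/Ps]] //.
by apply: PR cE; apply: Ps.
Qed.

(** A resolvent enters only if no present clause subsumes it, and the clauses that it subsumes
    leave. *)
Lemma exhaust_irredundant X s t :
  resolve_exhaustively X s t -> irredundant s -> irredundant t.
Proof.
elim=> // {}s t' u [c1 [c2 [c [_ _ _ cN ->]]]] _ IH irr.
apply: IH => d e; rewrite !inE.
move=> /orP[/eqP->|/andP[ds cd]] /orP[/eqP->|/andP[es ce]] //.
- by rewrite (negPf ce).
- by move=> dc; case/negP: cN; apply/existsP; exists d; rewrite ds.
- exact: irr.
Qed.

(** A clause leaves only when the new resolvent subsumes it. *)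
Lemma exhaust_cover X s t c : resolve_exhaustively X s t -> c \in s ->
  exists2 c', c' \in t & subsumes c' c.
Proof.
move=> st.
elim: st c => [{}s _ c cs|{}s t' u [c1 [c2 [d [_ _ _ _ ->]]]] _ IH c cs].
  by exists c => //; apply: subsumes_refl.
have [dc|dNc] := boolP (subsumes d c); last first.
  by apply: IH; rewrite !inE cs dNc orbT.
have [|c' c't c'd] := IH d; first by rewrite !inE eqxx.
by exists c' => //; apply: subsumes_trans dc.
Qed.

Lemma exhaust_closed X s t c1 c2 c : resolve_exhaustively X s t ->
  c1 \in t -> c2 \in t -> resolvent X c1 c2 = Some c ->
  exists2 c', c' \in t & subsumes c' c.
Proof.
elim=> // {}s done c1s c2s cE.
have [/existsP[c' /andP[]]|Nsub] := boolP [exists c' in s, subsumes c' c].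
  by exists c'.
by case: (done (c |: [set c' in s | ~~ subsumes c c'])); exists c1, c2, c.
Qed.

(** Termination of the loop yields a run, which is what the converse half of the final equivalence
    requires. *)
Lemma exhaust_total X s : exists t, resolve_exhaustively X s t.
Proof.
elim/(well_founded_ind (@resolve_step_wf Var St X)): s => s IH.
have [/existsP[c1 /existsP[c2 /existsP[c /and4P[c1s c2s /eqP cE cN]]]]|stuck] :=
  boolP [exists c1, exists c2, exists c, [&& c1 \in s, c2 \in s,
          resolvent X c1 c2 == Some c & ~~ [exists c' in s, subsumes c' c]]].
  have st : resolve_step X s (c |: [set c' in s | ~~ subsumes c c']).
    by exists c1, c2, c.
  have [u tu] := IH _ st; exists u; exact: resolve_more st tu.
exists s; apply: resolve_done => t [c1 [c2 [c [c1s c2s cE cN _]]]].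
case/negP: stuck; apply/existsP; exists c1; apply/existsP; exists c2.
by apply/existsP; exists c; rewrite c1s c2s cE eqxx.
Qed.

(* Invariant of Tison's method: the box which is B on the variables resolved so
   far and a point of B elsewhere lies in the falsifying box of one clause. *)
Definition covers (P : pred Var) (B : forall X, {set St X}) s :=
  forall w, (forall X, w X \in B X) ->
    exists2 c, c \in s &
      ~~ csat c w /\ forall Y, P Y -> [disjoint val c Y & B Y].

(** Resolving on [X] intersects the [X]-literals, so it unites the [X]-sides of two falsifying
    boxes; elsewhere the literals are united, and what both clauses avoid stays avoided. The clauses
    covering the variants of [w] at [X] thus merge, state by state, into one avoiding all of
    [B X]. *)
Lemma exhaust_covers X (P : pred Var) B s t :
  resolve_exhaustively X s t -> covers P B s -> covers [predU1 X & P] B t.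
Proof.
move=> st cov w wB.
(* Induction on a list of states of [B X] to be avoided at [X]; it is applied in the end to the
   enumeration of [B X]. *)
have cover_sub (r : seq (St X)) : {subset r <= B X} ->
  exists2 c, c \in t & [/\ forall a, a \in r -> a \notin val c X,
    forall Y, Y != X -> w Y \notin val c Y &
    forall Y, Y != X -> P Y -> [disjoint val c Y & B Y]].
  (* The invariant passes from [s] to [t], because a subsuming clause has a larger falsifying
     box. *)
  have base w' : (forall Y, w' Y \in B Y) -> exists2 c, c \in t &
      ~~ csat c w' /\ forall Y, P Y -> [disjoint val c Y & B Y].
    move=> /cov[c cs [cw' cB]]; have [c' c't c'c] := exhaust_cover st cs.
    exists c' => //; split; first exact: subsumes_csatN cw'.
    by move=> Y /cB; apply: disjointWl; apply: (subsumesP _ _ c'c).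
  elim: r => [_|a r IH rB].
    have [c ct [/csatPn cw cB]] := base w wB; exists c => //.
    by split=> // Y _; apply: cB.
  have [b br|c1 c1t [c1X c1w c1B]] := IH.
    by apply: rB; rewrite inE br orbT.
  (* The new state [a] is handled by the clause covering [w] with its state at [X] changed to
     [a]. *)
  have [|c2 c2t [/csatPn c2w c2B]] := base (finfun (dfwith w a)).
    move=> Y; rewrite ffunE; case: dfwithP => //.
    by apply: rB; rewrite inE eqxx.
  have c2X : a \notin val c2 X by have := c2w X; rewrite ffunE dfwith_in.
  have {}c2w Y : Y != X -> w Y \notin val c2 Y.
    by rewrite eq_sym => XY; have := c2w Y; rewrite ffunE dfwith_out.
  (* A clause without [X] already avoids every state of [X]; only if both clauses mention [X] must
     they be resolved. *)
  have [Xc1|/notin_cvars c1X0] := boolP (X \in cvars c1); last first.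
    by exists c1 => //; split=> // b _; rewrite c1X0 inE.
  have [Xc2|/notin_cvars c2X0] := boolP (X \in cvars c2); last first.
    exists c2 => //; split=> // [b _|Y _]; first by rewrite c2X0 inE.
    exact: c2B.
  have [|c cE] := resolvent_some (w := w) Xc1 Xc2.
    by move=> Y YX; rewrite c1w ?c2w.
  (* [t] may hold only a clause subsuming the resolvent; its literals are smaller, so they avoid the
     same states. *)
  have [c' c't /subsumesP c'c] := exhaust_closed st c1t c2t cE.
  move/resolventP in cE; exists c' => //; split=> [b|Y YX|Y YX PY].
  - rewrite inE => bar; apply: contraNN (c2X) => /(subsetP (c'c X)).
    rewrite cE eqxx inE => /andP[bc1 bc2].
    by case/orP: bar bc1 bc2 => [/eqP->//|/c1X/negPf->].
  - apply: contraNN (c1w Y YX) => /(subsetP (c'c Y)).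
    by rewrite cE (negPf YX) inE (negPf (c2w Y YX)) orbF.
  - apply: disjointWl (c'c Y) _; rewrite cE (negPf YX).
    by rewrite -setI_eq0 setIUl setU_eq0 !setI_eq0 c1B ?c2B.
have [a|c ct [cX cw cB]] := cover_sub (enum (B X)); first by rewrite mem_enum.
have {}cX : [disjoint val c X & B X].
  by rewrite disjoint_sym disjoints_subset; apply/subsetP => a aB;
     rewrite inE cX ?mem_enum.
exists c => //; split=> [|Y].
  apply/csatPn => Y; have [->|/cw//] := eqVneq Y X.
  by rewrite (disjointFl cX).
by have [->|YX] := eqVneq Y X ; rewrite //= (negPf YX); apply: cB.
Qed.

Lemma resolve_vars_covers Xs (P : pred Var) B s t : resolve_vars Xs s t ->
  covers P B s -> covers [predU Xs & P] B t.
Proof.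
elim: Xs P s => /= [|X Xs IH] P s.
  by move=> -> cov w /cov[c cs [cw cB]]; exists c => //; split.
case=> u su ut /(exhaust_covers su)/(IH _ _ ut) cov w /cov[c ct [cw cB]].
exists c => //; split=> // Y PY; apply: cB; move: PY; rewrite !inE.
by case: (Y == X); case: (Y \in Xs).
Qed.

Lemma resolve_vars_stable Xs s t (P : pred (clause St)) :
  (forall X c1 c2 c, P c1 -> P c2 -> resolvent X c1 c2 = Some c -> P c) ->
  resolve_vars Xs s t -> (forall c, c \in s -> P c) -> forall c, c \in t -> P c.
Proof.
move=> PR; elim: Xs s => /= [|X Xs IH] s; first by move=> ->.
by case=> u su ut Ps; apply: IH ut _; apply: exhaust_stable su Ps; apply: PR.
Qed.

Lemma resolve_vars_irredundant Xs s t :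
  resolve_vars Xs s t -> irredundant s -> irredundant t.
Proof.
elim: Xs s => /= [|X Xs IH] s; first by move=> ->.
by case=> u su ut irr; apply: IH ut _; apply: exhaust_irredundant su irr.
Qed.

Lemma resolve_vars_total Xs s : exists t, resolve_vars Xs s t.
Proof.
elim: Xs s => /= [|X Xs IH] s; first by exists s.
by have [u su] := exhaust_total X s; have [t ut] := IH u; exists t, u.
Qed.

(** * Models of the complete and general reasons *)

Lemma box_nnf (P : forall X : Var, literal St X -> bool)
    (A : forall X, {set St X}) :
  (forall X, A X = setT \/ exists2 l : literal St X, val l = A X & P X l) ->
  exists2 g, all_literals P g & forall w, nsat g w = [forall X, w X \in A X].
Proof.
move=> PA.
suff [g Pg gE] : exists2 g, all_literals P g &
    forall w, nsat g w = all (fun X => w X \in A X) (enum Var).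
  exists g => // w; rewrite gE.
  by apply/allP/forallP => h X; rewrite h ?mem_enum.
elim: (enum Var) => [|X Xs [g Pg gE]]; first by exists NTrue.
have [AT|[l lE Pl]] := PA X; first by exists g => // w; rewrite gE /= AT inE.
by exists (NAnd (NLit l) g) => [|w] /=; rewrite ?Pl // lE gE.
Qed.

(** Literals that hold at [I] survive resetting states to those of [I], and an NNF is monotone in
    its literals. *)
Lemma nsat_implied I f w w' : all_literals (literal_implied I) f ->
  (forall X, w' X = I X \/ w' X = w X) -> nsat f w -> nsat f w'.
Proof.
move=> + ww'; elim: f => [||X l|f IHf g IHg|f IHf g IHg] //=.
- by rewrite /literal_implied; have [->|->] := ww' X.
- by case/andP=> /IHf + /IHg + /andP[fw gw] => ->; rewrite ?gw // => ->.
- by case/andP=> /IHf + /IHg + /orP[fw|gw] => [-> //|_ ->]; rewrite ?orbT.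
Qed.

Lemma nsat_in I f w w' : all_literals (literal_in I) f ->
  (forall X, w X = I X -> w' X = I X) -> nsat f w -> nsat f w'.
Proof.
move=> + ww'; elim: f => [||X l|f IHf g IHg|f IHf g IHg] //=.
- by rewrite /literal_in => /eqP->; rewrite !inE => /eqP/ww'->.
- by case/andP=> /IHf + /IHg + /andP[fw gw] => ->; rewrite ?gw // => ->.
- by case/andP=> /IHf + /IHg + /orP[fw|gw] => [-> //|_ ->]; rewrite ?orbT.
Qed.

Section Reasons.

Context (I : world St) (Delta : pred (world St)).

(** The box with side [{I X, w X}] at each [X] is the strongest conjunction of literals that hold at
    both [I] and [w]. If it lies inside [Delta], it is one of the formulas that the weakest reason
    must be implied by. *)
Lemma general_reasonP f w : general_reason I Delta f ->
  nsat f w <-> forall w', (forall X, w' X = I X \/ w' X = w X) -> Delta w'.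
Proof.
case=> fI /entailsP fD fmax; split=> [fw w' /(nsat_implied fI)/(_ fw)/fD //|wD].
have [|g gI gE] := box_nnf (P := literal_implied I)
    (A := fun X => [set I X; w X]).
  move=> X; have [->|AT] := eqVneq [set I X; w X] setT; [by left|right].
  have lP : is_literal [set I X; w X].
    rewrite /is_literal AT andbT; apply/set0Pn; exists (I X).
    by rewrite !inE eqxx.
  by exists (Sub _ lP); rewrite // /literal_implied SubK !inE eqxx.
have /entailsP : entails (nsat g) (nsat f).
  apply: fmax => //; apply/entailsP => w'; rewrite gE => /forallP w'P.
  by apply: wD => X; have := w'P X; rewrite !inE => /orP[]/eqP; [left|right].
by apply; rewrite gE; apply/forallP => X; rewrite !inE eqxx orbT.
Qed.

(** The same argument with the conjunction of those simple literals of [I] that hold at [w]. *)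
Lemma complete_reasonP f w : complete_reason I Delta f ->
  nsat f w <-> forall w', (forall X, w X = I X -> w' X = I X) -> Delta w'.
Proof.
case=> fI /entailsP fD fmax; split=> [fw w' /(nsat_in fI)/(_ fw)/fD //|wD].
have [|g gI gE] := box_nnf (P := literal_in I)
    (A := fun X => if w X == I X then [set I X] else setT).
  move=> X; case: eqP => [_|]; [right|by left].
  have lP : is_literal [set I X].
    rewrite /is_literal -card_gt0 cards1 /=; apply: contraTneq (St_ge2 X) => IT.
    by rewrite -cardsT -IT cards1.
  by exists (Sub _ lP); rewrite // /literal_in SubK.
have /entailsP : entails (nsat g) (nsat f).
  apply: fmax => //; apply/entailsP => w'; rewrite gE => /forallP w'P.
  by apply: wD => X /eqP wX; have := w'P X; rewrite wX inE => /eqP.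
by apply; rewrite gE; apply/forallP => X; case: eqP => [->|_]; rewrite inE.
Qed.

(** * Falsifiable sets and implicates of the general reason *)

Definition falsifiable v :=
  [exists w : world St,
    [forall X, (X \notin v) ==> (w X == I X)] && ~~ Delta w].

Lemma falsifiableP v :
  reflect (exists2 w, agree_off v I w & ~~ Delta w) (falsifiable v).
Proof.
apply: (iffP existsP) => [[w /andP[/forallP wI wD]]|[w wI wD]]; exists w => //.
  by move=> X Xv; apply/eqP; have := wI X; rewrite Xv.
by rewrite wD andbT; apply/forallP => X; apply/implyP => /wI->.
Qed.

(** Falsify [c] on its own variables and keep [I] elsewhere. The general reason fails at this world,
    so some world mixing its states with those of [I] leaves [Delta], and that world still agrees
    with [I] off [cvars c]. *)
Lemma implicate_falsifiable f c : general_reason I Delta f ->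
  implicate f c -> falsifiable (cvars c).
Proof.
move=> fg /entailsP fc.
have [|u uc] := exists_world (B := fun X => ~: val c X).
  by move=> X; rewrite -setCT (inj_eq (@setC_inj _)) clause_neqT.
apply/falsifiableP.
pose w : world St := finfun (fun X => if X \in cvars c then u X else I X).
have wI : agree_off (cvars c) I w by move=> X /negPf Xc; rewrite ffunE Xc.
have cw : ~~ csat c w.
  apply/csatPn => X.
  have [Xc|/notin_cvars->] := boolP (X \in cvars c); last by rewrite inE.
  by have := uc X; rewrite ffunE Xc inE.
have [/forallP wD|] := boolP [forall w' : world St,
    [forall X, (w' X == I X) || (w' X == w X)] ==> Delta w'].
  case/negP: cw; apply/fc/(general_reasonP _ fg) => w' w'P.
  apply: (implyP (wD w')); apply/forallP => X.
  by have [->|->] := w'P X; rewrite eqxx ?orbT.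
rewrite negb_forall => /existsP[w'].
rewrite negb_imply => /andP[/forallP w'P w'D].
exists w' => // X Xc; have := w'P X; rewrite (wI X Xc).
by rewrite orbb => /eqP.
Qed.

Lemma falsifiable_implicate f v : general_reason I Delta f ->
  falsifiable v -> exists2 c, implicate f c & cvars c \subset v.
Proof.
move=> fg /falsifiableP[u uI uD].
(* The clause says that some [X] where [u] leaves [I] does not have the state [u X]. Where it fails
   at [w], [u] mixes states of [I] and [w], so the general reason at [w] would put [u] in
   [Delta]. *)
have cP : is_clause
    (finfun (fun X => if u X == I X then set0 else ~: [set u X])).
  apply/forallP => X; rewrite ffunE; apply: set0_or_literal.
  case: (u X =P I X) => _; first exact: set0_neqT.
  by apply/eqP => /setP/(_ (u X)); rewrite !inE eqxx.
pose c : clause St := Sub _ cP.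
have cE X : val c X = if u X == I X then set0 else ~: [set u X].
  by rewrite SubK ffunE.
exists c; last first.
  apply/subsetP => X; rewrite in_cvars cE; apply: contraR => /uI->.
  by rewrite eqxx.
apply/entailsP => w fw; apply: contraNT uD => /csatPn cw.
apply: (general_reasonP w fg).1 => // X; have := cw X; rewrite cE.
by case: eqP => [|_]; [left|rewrite !inE negbK => /eqP; right].
Qed.

End Reasons.

(** * Correctness of Robustness *)

(* What robustness computes, for D v meaning that flipping exactly the variables
   in v falsifies the formula. *)
Definition robust_spec (D : pred {set Var})
    (rV : option nat * {set {set Var}}) :=
  match rV.1 with
  | None => (forall v, ~~ D v) /\ rV.2 = set0
  | Some n => [/\ exists v, v \in rV.2,
                  forall v, (v \in rV.2) = D v && (#|v| == n) &
                  forall v, D v -> n <= #|v|]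
  end.

Lemma robust_and (D1 D2 : pred {set Var}) r1 V1 r2 V2 :
  robust_spec D1 (r1, V1) -> robust_spec D2 (r2, V2) ->
  robust_spec (fun v => D1 v || D2 v)
    (if ltno r1 r2 then (r1, V1)
     else if ltno r2 r1 then (r2, V2) else (r1, V1 :|: V2)).
Proof.
rewrite /robust_spec; case: r1 r2 => [n1|] [n2|] /=.
- move=> [[v1 v1V] V1E D1n] [[v2 v2V] V2E D2n].
  case: (ltngtP n1 n2) => [lt12|lt21|eq12] /=; split.
  + by exists v1.
  + move=> v; rewrite V1E; case: (D1 v) => //=.
    apply/esym/negbTE/negP => /andP[/D2n + /eqP v1n].
    by rewrite v1n leqNgt lt12.
  + by move=> v /orP[/D1n//|/D2n]; apply: leq_trans; apply: ltnW.
  + by exists v2.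
  + move=> v; rewrite V2E; case: (D2 v); rewrite ?orbT ?orbF //=.
    apply/esym/negbTE/negP => /andP[/D1n + /eqP v1n].
    by rewrite v1n leqNgt lt21.
  + by move=> v /orP[/D1n|/D2n//]; apply: leq_trans; apply: ltnW.
  + by exists v1; rewrite inE v1V.
  + by move=> v; rewrite inE V1E V2E eq12 andb_orl.
  + by move=> v /orP[/D1n|/D2n]; rewrite ?eq12.
- move=> [v1V V1E D1n] [D2N _].
  split=> // v; rewrite ?V1E (negPf (D2N v)) orbF //.
  exact: D1n.
- move=> [D1N _] [v2V V2E D2n]; split=> // v; rewrite ?V2E (negPf (D1N v)) //=.
  exact: D2n.
- move=> [D1N ->] [D2N ->]; rewrite setU0; split=> // v.
  by rewrite (negPf (D1N v)) (negPf (D2N v)).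
Qed.

(** Since each condition sees only its own block of variables and the blocks are disjoint, a
    smallest set for both is a disjoint union of smallest sets for each. *)
Lemma robust_or (D1 D2 : pred {set Var}) U1 U2 r1 V1 r2 V2 :
  (forall v, D1 v = D1 (v :&: U1)) -> (forall v, D2 v = D2 (v :&: U2)) ->
  [disjoint U1 & U2] ->
  robust_spec D1 (r1, V1) -> robust_spec D2 (r2, V2) ->
  robust_spec (fun v => D1 v && D2 v)
    (addno r1 r2, [set v1 :|: v2 | v1 in V1, v2 in V2]).
Proof.
move=> D1U D2U U12; rewrite /robust_spec; case: r1 r2 => [n1|] [n2|] /=.
- move=> [[v1 v1V] V1E D1n] [[v2 v2V] V2E D2n].
  (* [v :&: U1] satisfies [D1] too, so a set of minimum size has nothing outside [U1]. *)
  have sub1 v : v \in V1 -> v \subset U1.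
    rewrite V1E D1U => /andP[/D1n le /eqP vn]; apply/setIidPl/eqP.
    by rewrite eqEcard subsetIl vn.
  have sub2 v : v \in V2 -> v \subset U2.
    rewrite V2E D2U => /andP[/D2n le /eqP vn]; apply/setIidPl/eqP.
    by rewrite eqEcard subsetIl vn.
  have dis0 (u1 u2 : {set Var}) : 
      u1 \subset U1 -> u2 \subset U2 -> u1 :&: u2 = set0.
    by move=> u1U u2U; apply/disjoint_setI0/(disjointWl u1U)/(disjointWr u2U).
  have cardE v : #|v :&: U1 :|: v :&: U2| = #|v :&: U1| + #|v :&: U2|.
    by rewrite cardsU (dis0 (v :&: U1)) ?subsetIr // cards0 subn0.
  have le v : #|v :&: U1| + #|v :&: U2| <= #|v|.
    by rewrite -cardE -setIUr subset_leq_card ?subsetIl.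
  split; first by exists (v1 :|: v2); apply: imset2_f.
  + move=> v; apply/imset2P/andP.
    - move=> [u1 u2 u1V u2V ->].
      have [u1U u2U] := (sub1 _ u1V, sub2 _ u2V).
      move: u1V u2V; rewrite V1E V2E.
      move=> /andP[D1u1 /eqP u1n] /andP[D2u2 /eqP u2n].
      rewrite cardsU dis0 // cards0 subn0 u1n u2n eqxx /= D1U D2U !setIUl.
      rewrite (setIidPl u1U) (setIidPl u2U) (setIC u2 U1).
      by rewrite (dis0 u1 U2) // (dis0 U1 u2) // setU0 set0U D1u1.
    move=> [/andP[D1v D2v] /eqP vn]; rewrite D1U in D1v; rewrite D2U in D2v.
    (* The two traces have at least [n1] and [n2] elements and together at most [n1 + n2], so both
       bounds are attained. *)
    have [[le1 le2] lev] := (D1n _ D1v, D2n _ D2v, le v).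
    have n1E : #|v :&: U1| = n1.
      apply/eqP; rewrite eqn_leq le1 andbT -(leq_add2r n2) -vn.
      by apply: leq_trans lev; rewrite leq_add2l.
    have n2E : #|v :&: U2| = n2.
      by apply/eqP; rewrite eqn_leq le2 andbT -(leq_add2l n1) -vn -{1}n1E.
    exists (v :&: U1) (v :&: U2);
      rewrite ?V1E ?V2E ?D1v ?D2v ?n1E ?n2E ?eqxx //.
    by apply/esym/eqP; rewrite eqEcard cardE n1E n2E vn leqnn -setIUr subsetIl.
  + move=> v /andP[]; rewrite D1U D2U => /D1n le1 /D2n le2.
    exact: leq_trans (leq_add le1 le2) (le v).
- move=> [v1V V1E D1n] [D2N ->].
  split=> [v|]; first by rewrite (negPf (D2N v)) andbF.
  by apply/setP => v; rewrite inE; apply/negP => /imset2P[? ? _]; rewrite inE.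
- move=> [D1N ->] _; split=> [v|]; first by rewrite (negPf (D1N v)).
  by apply/setP => v; rewrite inE; apply/negP => /imset2P[? ?]; rewrite inE.
- move=> [D1N ->] _; split=> [v|]; first by rewrite (negPf (D1N v)).
  by apply/setP => v; rewrite inE; apply/negP => /imset2P[? ?]; rewrite inE.
Qed.

Lemma eq_robust_spec D1 D2 rV :
  D1 =1 D2 -> robust_spec D1 rV -> robust_spec D2 rV.
Proof.
rewrite /robust_spec => D12.
case: rV.1 => [n [exV VE Vn]|[DN V0]]; split=> // v.
- by rewrite VE D12.
- by rewrite -D12; apply: Vn.
- by rewrite -D12.
Qed.

Lemma eq_nsat f w w' :
  (forall X, X \in nvars f -> w X = w' X) -> nsat f w = nsat f w'.
Proof.
elim: f => [||X l|f IHf g IHg|f IHf g IHg] //= ww'.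
- by rewrite ww' ?set11.
- by rewrite IHf ?IHg // => X Xf; apply: ww'; rewrite inE Xf ?orbT.
- by rewrite IHf ?IHg // => X Xf; apply: ww'; rewrite inE Xf ?orbT.
Qed.

Definition flip (I J : world St) v : world St :=
  finfun (fun X => if X \in v then J X else I X).

(** A literal contained in [I] fails as soon as its variable leaves [I], whatever the new state, so
    a single [J] differing from [I] everywhere represents all changes. *)
Lemma robustnessP (I J : world St) f : (forall X, J X != I X) ->
  all_literals (literal_in I) f -> or_decomposable f ->
  robust_spec (fun v => ~~ nsat f (flip I J v)) (robustness f).
Proof.
move=> JI; have flipU g v :
    ~~ nsat g (flip I J v) = ~~ nsat g (flip I J (v :&: nvars g)).
  by congr negb; apply: eq_nsat => X Xg; rewrite !ffunE inE Xg andbT.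
elim: f => [||X l|f IHf g IHg|f IHf g IHg] /=.
- by [].
- move=> _ _; split=> [|v|//]; first by exists set0; rewrite inE.
  by rewrite inE cards_eq0.
- rewrite /literal_in => /eqP-> _.
  have flipX v : (flip I J v X != I X) = (X \in v).
    by rewrite ffunE; case: ifP => _; rewrite ?JI ?eqxx.
  split=> [|v|v] /=; first by exists [set X]; rewrite inE.
    rewrite !in_set1 flipX; apply/eqP/andP => [->|[Xv /cards1P[Y vE]]].
      by rewrite set11 cards1.
    by move: Xv; rewrite vE inE => /eqP->.
  by rewrite in_set1 flipX => Xv; rewrite card_gt0; apply/set0Pn; exists X.
- case/andP=> fI gI /andP[fD gD]; move: (IHf fI fD) (IHg gI gD).
  case: (robustness f) (robustness g) => [r1 V1] [r2 V2] f_spec g_spec.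
  apply: eq_robust_spec (robust_and f_spec g_spec) => v.
  by rewrite negb_and.
- case/andP=> fI gI /and3P[fg fD gD]; move: (IHf fI fD) (IHg gI gD).
  case: (robustness f) (robustness g) => [r1 V1] [r2 V2] f_spec g_spec.
  apply: eq_robust_spec (robust_or (flipU f) (flipU g) fg f_spec g_spec) => v.
  by rewrite negb_or.
Qed.

(** * Shortest GNRs and the output of sGNR *)

Section Shortest.

Context (I : world St) (Delta : pred (world St)) (Delta_c Delta_g : nnf St).
Context (hc : complete_reason I Delta Delta_c).
Context (hc_dec : or_decomposable Delta_c).
Context (hg : general_reason I Delta Delta_g).

Let V := (robustness Delta_c).2.

(** [flip I J v] agrees with [I] exactly off [v], and the complete reason holds there just when all
    worlds keeping these agreements are in [Delta]. *)
Lemma falsifiable_flip (J : world St) : (forall X, J X != I X) ->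
  falsifiable I Delta =1 fun v => ~~ nsat Delta_c (flip I J v).
Proof.
move=> JI v; have flipI X : (flip I J v X == I X) = (X \notin v).
  by rewrite ffunE; case: ifP => _; rewrite ?eqxx // (negPf (JI X)).
apply/falsifiableP/idP => [[w wI]|].
  apply: contra => /(complete_reasonP _ hc); apply=> X /eqP.
  by rewrite flipI => /wI.
have [/forallP wD|] := boolP [forall w : world St,
    [forall X, (X \notin v) ==> (w X == I X)] ==> Delta w].
  case/negP; apply/(complete_reasonP _ hc) => w wI; apply: (implyP (wD w)).
  by apply/forallP => X; rewrite -flipI; apply/implyP => /eqP/wI->.
rewrite negb_forall => /existsP[w].
rewrite negb_imply => /andP[/forallP wI wD] _.
by exists w => // X Xv; apply/eqP/(implyP (wI X)).
Qed.

Lemma robustness_minimal v : v \in V <-> falsifiable I Delta v /\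
  forall v', falsifiable I Delta v' -> #|v| <= #|v'|.
Proof.
(* Every variable has a second state, so some [J] differs from [I] everywhere. *)
have [|J JI] := exists_world (B := fun X => ~: [set I X]).
  move=> X; apply: contraTneq (St_ge2 X) => /(congr1 (@setC _)).
  by rewrite setCK setC0 -cardsT => <-; rewrite cards1.
have {}JI X : J X != I X by have := JI X; rewrite !inE.
have [cI _ _] := hc; have := robustnessP JI cI hc_dec.
have DE := falsifiable_flip JI.
rewrite /robust_spec -/V.
case: (robustness Delta_c).1 => [n [[v0 v0V] VE Vn]|[cN ->]].
  rewrite VE -DE; split=> [/andP[vD /eqP->]|[vD v_min]].
    by split=> // v'; rewrite DE; apply: Vn.
  rewrite vD eqn_leq Vn -?DE // andbT.
  by move: v0V; rewrite VE -DE => /andP[/v_min + /eqP<-].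
by rewrite inE; split=> // -[]; rewrite DE (negPf (cN v)).
Qed.

Lemma minimal_exists v : falsifiable I Delta v -> exists v', v' \in V.
Proof.
move=> vD; case: (arg_minnP (fun v' : {set Var} => #|v'|) vD) => v' v'D v'_min.
by exists v'; apply/robustness_minimal; split.
Qed.

Lemma implicate_cvars v c : v \in V -> implicate Delta_g c ->
  cvars c \subset v -> cvars c = v.
Proof.
move=> /robustness_minimal[_ v_min] /(implicate_falsifiable hg)/v_min le sub.
by apply/eqP; rewrite eqEcard sub.
Qed.

Lemma shortest_GNR_robustness c :
  shortest_GNR Delta_g c = prime_implicate Delta_g c && (cvars c \in V).
Proof.
have V_min v c' : v \in V -> prime_implicate Delta_g c' -> #|v| <= #|cvars c'|.
  move=> /robustness_minimal[_ v_min] /andP[/(implicate_falsifiable hg) + _].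
  exact: v_min.
have V_GNR c' : prime_implicate Delta_g c' -> cvars c' \in V -> GNR Delta_g c'.
  move=> c'P c'V; rewrite /GNR c'P; apply/forallP => d; apply/implyP => dP.
  by apply/negP => /proper_card; rewrite ltnNge V_min.
apply/andP/andP => [[cG c_min]|[cP cV]]; last first.
  split; first exact: V_GNR.
  apply/forallP => d; apply/implyP => /andP[dP _].
  by rewrite -leqNgt V_min.
have [cP _] := andP cG; split=> //; have [cI _] := andP cP.
have cD := implicate_falsifiable hg cI.
have [v vV] := minimal_exists cD.
have [vD v_min] := (robustness_minimal v).1 vV.
(* An implicate within [v] is shrunk to a prime one, whose variables must still be all of [v]. This
   gives a GNR of size [#|v|], which bounds the size of the shortest GNR [c]. *)
have [d0 d0I d0v] := falsifiable_implicate hg vD.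
have [d [dI dd0 d_min]] := exists_minimal (A := implicate Delta_g) d0I.
have dv : cvars d = v.
  exact/(implicate_cvars vV dI)/(subset_trans (subsumes_cvars dd0)).
have dP : prime_implicate Delta_g d.
  rewrite /prime_implicate dI; apply/forallP => e; apply/implyP => /andP[eI ed].
  exact/eqP/d_min.
have dG : GNR Delta_g d by apply: V_GNR; rewrite ?dv.
apply/robustness_minimal; split=> // v' /v_min; apply: leq_trans.
by have /forallP/(_ d) := c_min; rewrite dG -leqNgt dv.
Qed.

Lemma resolve_vars_prime v Xs t : v \in V -> perm_eq Xs (enum v) ->
  resolve_vars Xs [set c in sCNF Delta_g V | cvars c == v] t ->
  t = [set c | prime_implicate Delta_g c && (cvars c == v)].
Proof.
move=> vV Xsv st; set s := [set c in _ | _] in st.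
have [gI _ _] := hg.
have t_sound c : c \in t -> implicate Delta_g c /\ cvars c = v.
  pose P c := implicate Delta_g c && (cvars c \subset v).
  suff /[apply] /andP[cI cv] : forall c, c \in t -> P c.
    by split=> //; apply: implicate_cvars.
  apply: resolve_vars_stable st _ => [X c1 c2 c'|c'].
    move=> /andP[c1I c1v] /andP[c2I c2v] cE.
    by rewrite /P (resolvent_implicate cE) ?(resolvent_cvars cE).
  by rewrite inE => /andP[/sCNF_implicate c'I /eqP c'v]; rewrite /P c'I c'v /=.
have t_irr : irredundant t.
  apply: resolve_vars_irredundant st _ => c d.
  rewrite !inE => /andP[cs _] /andP[ds _]; exact: irredundant_sCNF ds.
have t_complete d : implicate Delta_g d -> cvars d \subset v ->
    exists2 c, c \in t & subsumes c d.
  move=> /entailsP dI dv; have dv' := subsetP dv.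
  (* The invariant starts on the falsifying box of [d]: a point of it is moved back to [I] off [v],
     where [d] has no literal and [sCNF_falsified] applies. *)
  have s_covers : covers pred0 (fun X => ~: val d X) s.
    move=> w wd; pose w' := flip I w v.
    have w'I : agree_off v I w' by move=> X /negPf Xv; rewrite ffunE Xv.
    have w'd : ~~ csat d w'.
      apply/csatPn => X; have [Xd|/notin_cvars->] := boolP (X \in cvars d).
        by have := wd X; rewrite ffunE dv' // inE.
      by rewrite inE.
    have [|c cs /andP[cv /csatPn cw']] := sCNF_falsified gI vV w'I.
      exact: contra (dI w') w'd.
    have c_v := implicate_cvars vV (sCNF_implicate cs) cv.
    exists c; first by rewrite inE cs c_v eqxx.
    split=> //; apply/csatPn => X; have := cw' X; rewrite ffunE.
    by case: ifP => // Xv _; rewrite notin_cvars ?in_set0 // c_v Xv.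
  have [|u ud] := exists_world (B := fun X => ~: val d X).
    by move=> X; rewrite -setCT (inj_eq (@setC_inj _)) clause_neqT.
  have [c ct [_ cd]] := resolve_vars_covers st s_covers ud.
  (* With all of [v] resolved, [c] avoids the complement of [d] on [v], which is inclusion of
     literals. *)
  exists c => //; apply/subsumesP => X; have [Xv|Xv] := boolP (X \in v).
    rewrite -[val d X]setCK -disjoints_subset cd // !inE.
    by rewrite (perm_mem Xsv) mem_enum Xv.
  by rewrite notin_cvars ?sub0set // (t_sound c ct).2.
apply/setP => c; rewrite inE; apply/idP/andP => [ct|[/andP[cI c_min] /eqP cv]].
  have [cI cv] := t_sound c ct; split; last by rewrite cv.
  rewrite /prime_implicate cI; apply/forallP => d; apply/implyP => /andP[dI dc].
  (* An implicate [d] below [c] has some [e] of [t] below it; the antichain property gives [e = c],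
     hence [d = c]. *)
  have [|e et ed] := t_complete d dI; first by rewrite -cv subsumes_cvars.
  have ec := t_irr _ _ et ct (subsumes_trans ed dc).
  by apply/eqP/subsumes_anti => //; rewrite -ec.
have [|d dt dc] := t_complete c cI; first by rewrite cv.
have [dI _] := t_sound d dt.
by have := forallP c_min d; rewrite dI dc => /eqP<-.
Qed.

Lemma sGNR_shortest s :
  sGNR Delta_g V s <-> s = [set c | shortest_GNR Delta_g c].
Proof.
pose T v := [set c | prime_implicate Delta_g c && (cvars c == v)].
have TE : [set c | shortest_GNR Delta_g c] = \bigcup_(v in V) T v.
  apply/setP => c; rewrite inE shortest_GNR_robustness.
  apply/andP/bigcupP => [[cP cV]|[v vV]].
    by exists (cvars c); rewrite // inE cP /=.
  by rewrite inE => /andP[cP /eqP->].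
rewrite TE; split=> [[S SV ->]|->].
  apply: eq_bigr => v vV.
  by have [Xs XsP /(resolve_vars_prime vV XsP)] := SV v vV.
exists T => // v vV; exists (enum v) => //.
(* Some run exists, and its result can only be [T v]. *)
have [t vt] :=
  resolve_vars_total (enum v) [set c in sCNF Delta_g V | cvars c == v].
by rewrite /T -(resolve_vars_prime vV (perm_refl _) vt).
Qed.

End Shortest.

End Clauses.

Theorem proposition5 (Var : finType) (St : Var -> finType)
    (St_ge2 : forall X : Var, 1 < #|St X|)
    (I : world St) (Delta : pred (world St)) (Delta_c Delta_g : nnf St)
    (hI : Delta I)
    (hc : complete_reason I Delta Delta_c)
    (hc_dec : or_decomposable Delta_c)
    (hg : general_reason I Delta Delta_g) :
  forall S : {set clause St},
    sGNR Delta_g (robustness Delta_c).2 S <->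
    S = [set c | shortest_GNR Delta_g c].
Proof. by move=> S; exact: (sGNR_shortest St_ge2 hc hc_dec hg). Qed.
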